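(* Let $\Sigma$ be finite, $\Gamma=2^\Sigma\setminus\{\emptyset\}$. (a) For every 1-clock ATA $\mathcal{A}$ over $\Gamma$ there is a $\mu\mathsf{RatMTL}$ sentence $\psi$ with $L(\psi)=L(\mathcal{A})$. (b) For every $\mathsf{C}\oplus\mathsf{D}$ 1-clock ATA $\mathcal{A}$ over $\Gamma$ there is a $\mu\mathsf{FRatMTL}$ sentence $\psi$ with $L(\psi)=L(\mathcal{A})$.
   Context: Timed words $\rho=(\sigma,\tau)$: $\sigma_i\in\Gamma$, $\tau_i\in\mathbb{R}_{\ge0}$, $\tau_1=0$, $\tau_i\le\tau_{i+1}$. Intervals: intervals of $\mathbb{R}_{\ge0}$ with endpoints in $\mathbb{N}\cup\{\infty\}$. 1-clock ATA $\mathcal{A}=(\Gamma,Q,q_0,F,\delta)$, $\delta:Q\times\Gamma\to\Phi(Q)$, $\Phi(Q)$: $\varphi::=\top\mid\bot\mid\varphi\wedge\varphi\mid\varphi\vee\varphi\mid q\mid x\in I\mid x.q$ ($x.q$: go to $q$ resetting the clock $x$). A successor of configuration $C$ (finite set of $(q,\nu)$) on $a$ chooses for each $(s,\nu)\in C$ a set $M\subseteq Q\cup\{x.q\}$ satisfying $\delta(s,a)$ ($x\in I$ true iff $\nu\in I$) and unites $\{(p,\nu):p\in M\}\cup\{(q,0):x.q\in M\}$. Runs: $C_0=\{(q_0,0)\}$, $C_i$ a successor on $\sigma_i$ of $C_{i-1}$ with $\tau_i-\tau_{i-1}$ added to all valuations ($\tau_0=0$); accept iff some run ends with all locations in $F$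 (empty configuration accepting). $\mathsf{C}\oplus\mathsf{D}$: $Q=Q_\wedge\sqcup Q_\vee$; with $\mathcal{B}$ the positive Boolean combinations (incl. true, false) of atoms $x.q$: for $q\in Q_\wedge$, $\delta(q,a)=\bigwedge_i D_i$ with each $D_i\in\{q'\vee\beta\ (q'\in Q_\wedge),\ (x\in I)\vee\beta,\ \beta\}$, $\beta\in\mathcal{B}$; for $q\in Q_\vee$, $\delta(q,a)=\bigvee_iC_i$ with each $C_i\in\{q'\wedge\beta\ (q'\in Q_\vee),\ (x\in I)\wedge\beta,\ \beta\}$. $\mu\mathsf{RatMTL}$ over $\Sigma$ and a finite set $\mathcal{Z}$ of recursion variables: $\varphi::=a\mid\mathrm{true}\mid Z\mid\varphi\wedge\varphi\mid\neg\varphi\mid\mathsf{Rat}_I\mathsf{re}(\mathsf{S})\mid\mathsf{FRat}_{I,\mathsf{re}(\mathsf{S})}\varphi\mid\mathsf{GRat}_{I,\mathsf{re}(\mathsf{S})}\varphi\mid\mu Z\circ\varphi\mid\nu Z\circ\varphi$ ($\mathsf{S}$ a finite set of formulas, $\mathsf{re}(\mathsf{S})$ a regular expression over $\mathsf{S}$). Formulas are interpreted on super structures, timed words over $\Gamma\times 2^{\mathcal{Z}}$; $\rho,i\models Z$ iff $Z$ is in the label at $i$; $\rho,i\models\mathsf{FRat}_{I,\mathsf{re}}\varphi$ iff $\exists j>i$: $\rho,j\models\varphi$, $\tau_j-\tau_i\in I$, and there are $\psi_k\in\mathsf{S}$ with $\rho,k\models\psi_k$ for $i<k<j$ and $\psi_{i+1}\cdots\psi_{j-1}\in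 L(\mathsf{re})$; $\rho,i\models\mathsf{Rat}_I\mathsf{re}$ iff, listing in increasing order the positions $k$ with $\tau_k-\tau_i\in I$, one can choose $\psi_k\in\mathsf S$ with $\rho,k\models\psi_k$ so that the resulting word is in $L(\mathsf{re})$; $\mathsf{GRat}_{I,\mathsf{re}}\varphi\equiv\neg\mathsf{FRat}_{I,\mathsf{re}}\neg\varphi$. $\rho'$ is a fixpoint of $Z\equiv\varphi(Z)$ w.r.t. $\rho$ if $\rho,\rho'$ agree except on $Z$ and for all $i$, $\rho',i\models\varphi$ iff $\rho',i\models Z$; it is least (greatest) if its set of $Z$-positions is contained in (contains) that of every such fixpoint. $\rho,i\models\mu Z\circ\varphi$ ($\nu Z\circ\varphi$) iff $\rho'',i\models Z$ for the least (greatest) fixpoint $\rho''$. A sentence has all recursion variables bound; its language is $\{\rho\text{ timed word over }\Sigma:\rho,1\models\psi\}$. $\mu\mathsf{FRatMTL}$ is the fragment without $\mathsf{Rat}_I$. Only guarded formulas are considered: in every subformula $\mu Z\circ\psi$ or $\nu Z\circ\psi$, every occurrence of $Z$ in $\psi$ lies within the scope of a strict-future modality. *)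

(* Defs.v *)
From HB Require Import structures.
From mathcomp Require Import all_boot all_order all_algebra finmap reals.

Set Implicit Arguments.
Unset Strict Implicit.
Unset Printing Implicit Defensive.

Import Order.TTheory GRing.Theory Num.Theory.

Local Open Scope ring_scope.

(** * Timed words and intervals *)

Definition letter (Sigma : finType) : Type := {a : {set Sigma} | a != set0}.

(* A timed word has length [tw_last.+1 >= 1]; position 1 of the usual
   1-based numbering is [ord0]. *)
Record timed_word (R : realType) (A : Type) := TimedWord {
  tw_last : nat;
  tw_sym : 'I_tw_last.+1 -> A;
  tw_time : 'I_tw_last.+1 -> R;
  tw_time0 : tw_time ord0 = 0;
  tw_timeS : forall i j : 'I_tw_last.+1,
    j = i.+1 :> nat -> tw_time i <= tw_time j }.

Notation tw_pos rho := 'I_(tw_last rho).+1.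

(* The booleans say whether the endpoint is included; upper endpoint [None]
   is infinity. *)
Record nat_itv := NatItv {
  itv_lo_closed : bool;
  itv_lo : nat;
  itv_hi : option (bool * nat) }.

Definition itv_of (R : numDomainType) (J : nat_itv) : interval R :=
  Interval (BSide (itv_lo_closed J) (itv_lo J)%:R)
           (if itv_hi J is Some (closed, h) then BSide (~~ closed) h%:R
            else +oo%O).

(** * 1-clock alternating timed automata *)

Inductive tcond (Q : Type) : Type :=
  | TTrue
  | TFalse
  | TAnd of tcond Q & tcond Q
  | TOr of tcond Q & tcond Q
  | TLoc of Q
  | TClock of nat_itv
  | TReset of Q.

Arguments TTrue {Q}.
Arguments TFalse {Q}.
Arguments TClock {Q}.

Record ata (A : Type) := ATA {
  ata_loc : finType;
  ata_init : ata_loc;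
  ata_final : {set ata_loc};
  ata_trans : ata_loc -> A -> tcond ata_loc }.

Section AtaSemantics.
Variables (R : realType) (A : Type) (M : ata A).
Local Notation Q := (ata_loc M).

(* In a choice [X : {set Q + Q}], [inl q] is the atom q and [inr q] is x.q. *)
Fixpoint tcond_sat (v : R) (X : {set Q + Q}) (phi : tcond Q) : bool :=
  match phi with
  | TTrue => true
  | TFalse => false
  | TAnd phi1 phi2 => tcond_sat v X phi1 && tcond_sat v X phi2
  | TOr phi1 phi2 => tcond_sat v X phi1 || tcond_sat v X phi2
  | TLoc q => inl q \in X
  | TClock J => v \in itv_of R J
  | TReset q => inr q \in X
  end.

Definition config : Type := {fset (Q * R)}.

Definition target (v : R) (x : Q + Q) : Q * R :=
  match x with inl p => (p, v) | inr q => (q, 0) end.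

Definition delay (d : R) (C : config) : config :=
  [fset (c.1, (c.2 + d)%R) | c in C]%fset.

Definition successor (a : A) (C C' : config) : Prop :=
  exists X : Q * R -> {set Q + Q},
    (forall c, c \in C -> tcond_sat c.2 (X c) (ata_trans c.1 a)) /\
    C' = (\bigcup_(c <- C) [fset target c.2 x | x in X c])%fset.

Definition prev_time (rho : timed_word R A) (i : tw_pos rho) : R :=
  if i == 0%N :> nat then 0 else tw_time (inord i.-1 : tw_pos rho).

(* Only [C 0], ..., [C (tw_last rho).+1] matter; [C i.+1] is reached by reading
   the letter at the 0-based position [i]. *)
Definition is_run (rho : timed_word R A) (C : nat -> config) : Prop :=
  C 0%N = [fset (ata_init M, 0)]%fset /\
  forall i : tw_pos rho,
    successor (tw_sym i) (delay (tw_time i - prev_time i) (C i)) (C i.+1).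

Definition ata_accepts (rho : timed_word R A) : Prop :=
  exists2 C, is_run rho C &
    forall c, c \in C (tw_last rho).+1 -> c.1 \in ata_final M.

End AtaSemantics.

Section CplusD.
Variable Q : finType.

Inductive reset_comb : tcond Q -> Prop :=
  | RcTrue : reset_comb TTrue
  | RcFalse : reset_comb TFalse
  | RcReset q : reset_comb (TReset q)
  | RcAnd b1 b2 : reset_comb b1 -> reset_comb b2 -> reset_comb (TAnd b1 b2)
  | RcOr b1 b2 : reset_comb b1 -> reset_comb b2 -> reset_comb (TOr b1 b2).

(* Finite conjunctions (disjunctions) in arbitrary bracketing; the empty one is
   covered by [reset_comb TTrue] ([reset_comb TFalse]). *)
Inductive conj_form (Qand : {set Q}) : tcond Q -> Prop :=
  | CfLoc q b : q \in Qand -> reset_comb b -> conj_form Qand (TOr (TLoc q) b)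
  | CfClock J b : reset_comb b -> conj_form Qand (TOr (TClock J) b)
  | CfReset b : reset_comb b -> conj_form Qand b
  | CfAnd d1 d2 : conj_form Qand d1 -> conj_form Qand d2 ->
                  conj_form Qand (TAnd d1 d2).

Inductive disj_form (Qor : {set Q}) : tcond Q -> Prop :=
  | DfLoc q b : q \in Qor -> reset_comb b -> disj_form Qor (TAnd (TLoc q) b)
  | DfClock J b : reset_comb b -> disj_form Qor (TAnd (TClock J) b)
  | DfReset b : reset_comb b -> disj_form Qor b
  | DfOr c1 c2 : disj_form Qor c1 -> disj_form Qor c2 ->
                 disj_form Qor (TOr c1 c2).

End CplusD.

Definition is_CplusD (A : Type) (M : ata A) : Prop :=
  exists Qand : {set ata_loc M}, forall (q : ata_loc M) (a : A),
    if q \in Qand then conj_form Qand (ata_trans q a)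
    else disj_form (~: Qand) (ata_trans q a).

(** * Regular expressions *)

Inductive regexp (S : Type) : Type :=
  | ReEmpty
  | ReEps
  | ReAtom of S
  | ReAlt of regexp S & regexp S
  | ReCat of regexp S & regexp S
  | ReStar of regexp S.

Arguments ReEmpty {S}.
Arguments ReEps {S}.

Inductive re_lang (S : Type) : regexp S -> seq S -> Prop :=
  | LEps : re_lang ReEps [::]
  | LAtom s : re_lang (ReAtom s) [:: s]
  | LAltL e1 e2 w : re_lang e1 w -> re_lang (ReAlt e1 e2) w
  | LAltR e1 e2 w : re_lang e2 w -> re_lang (ReAlt e1 e2) w
  | LCat e1 e2 w1 w2 :
      re_lang e1 w1 -> re_lang e2 w2 -> re_lang (ReCat e1 e2) (w1 ++ w2)
  | LStarNil e : re_lang (ReStar e) [::]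
  | LStarCat e w1 w2 :
      re_lang e w1 -> re_lang (ReStar e) w2 -> re_lang (ReStar e) (w1 ++ w2).

(** * The logic *)

(* The finite set S of formulas below a rational modality is given as a family
   [fs : 'I_n -> formula], and re(S) as an expression over the indices 'I_n. *)
Inductive formula (Sigma Z : finType) : Type :=
  | FProp of Sigma
  | FTrue
  | FVar of Z
  | FAnd of formula Sigma Z & formula Sigma Z
  | FNot of formula Sigma Z
  | FRatI (J : nat_itv) (n : nat) (fs : 'I_n -> formula Sigma Z)
      (e : regexp 'I_n)
  | FFRat (J : nat_itv) (n : nat) (fs : 'I_n -> formula Sigma Z)
      (e : regexp 'I_n) (phi : formula Sigma Z)
  | FGRat (J : nat_itv) (n : nat) (fs : 'I_n -> formula Sigma Z)
      (e : regexp 'I_n) (phi : formula Sigma Z)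
  | FMu of Z & formula Sigma Z
  | FNu of Z & formula Sigma Z.

Section Syntax.
Variables Sigma Z : finType.

Fixpoint free_vars (phi : formula Sigma Z) : {set Z} :=
  match phi with
  | FProp _ | FTrue => set0
  | FVar z => [set z]
  | FAnd phi1 phi2 => free_vars phi1 :|: free_vars phi2
  | FNot phi1 => free_vars phi1
  | FRatI _ _ fs _ => \bigcup_k free_vars (fs k)
  | FFRat _ _ fs _ phi1 | FGRat _ _ fs _ phi1 =>
      (\bigcup_k free_vars (fs k)) :|: free_vars phi1
  | FMu z phi1 | FNu z phi1 => free_vars phi1 :\ z
  end.

Definition is_sentence (phi : formula Sigma Z) : Prop := free_vars phi = set0.

(* FRat and GRat only look at later positions. Rat_I refers to all positions at
   distance in I, which includes the current one exactly when 0 lies in I, so it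
   is a strict-future modality only when 0 is not in I. *)
Fixpoint var_guarded (z : Z) (phi : formula Sigma Z) : Prop :=
  match phi with
  | FProp _ | FTrue => True
  | FVar z' => z' <> z
  | FAnd phi1 phi2 => var_guarded z phi1 /\ var_guarded z phi2
  | FNot phi1 => var_guarded z phi1
  | FRatI J _ fs _ =>
      0 \notin itv_of rat J \/ forall k, var_guarded z (fs k)
  | FFRat _ _ _ _ _ | FGRat _ _ _ _ _ => True
  | FMu _ phi1 | FNu _ phi1 => var_guarded z phi1
  end.

Fixpoint guarded (phi : formula Sigma Z) : Prop :=
  match phi with
  | FProp _ | FTrue | FVar _ => True
  | FAnd phi1 phi2 => guarded phi1 /\ guarded phi2
  | FNot phi1 => guarded phi1
  | FRatI _ _ fs _ => forall k, guarded (fs k)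
  | FFRat _ _ fs _ phi1 | FGRat _ _ fs _ phi1 =>
      (forall k, guarded (fs k)) /\ guarded phi1
  | FMu z phi1 | FNu z phi1 => var_guarded z phi1 /\ guarded phi1
  end.

Fixpoint Rat_free (phi : formula Sigma Z) : Prop :=
  match phi with
  | FProp _ | FTrue | FVar _ => True
  | FAnd phi1 phi2 => Rat_free phi1 /\ Rat_free phi2
  | FNot phi1 => Rat_free phi1
  | FRatI _ _ _ _ => False
  | FFRat _ _ fs _ phi1 | FGRat _ _ fs _ phi1 =>
      (forall k, Rat_free (fs k)) /\ Rat_free phi1
  | FMu _ phi1 | FNu _ phi1 => Rat_free phi1
  end.

End Syntax.

Section Semantics.
Variables (R : realType) (Sigma Z : finType).
Variable rho : timed_word R (letter Sigma).

(* A super structure over [rho] is [rho] together with a labelling of its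
   positions by sets of recursion variables. *)
Definition labelling : Type := tw_pos rho -> {set Z}.

(* [segment_in P sat e]: one can pick for each position [k] with [P k], in
   increasing order, an index [s] with [sat k s] such that the word of chosen
   indices is in the language of [e]; [w] lists the pairs (k, s). *)
Definition segment_in (P : pred (tw_pos rho)) (n : nat)
    (sat : tw_pos rho -> 'I_n -> Prop) (e : regexp 'I_n) : Prop :=
  exists w : seq (tw_pos rho * 'I_n),
    [/\ unzip1 w = [seq k <- enum 'I_(tw_last rho).+1 | P k],
        re_lang e (unzip2 w)
      & forall c, c \in w -> sat c.1 c.2].

Definition FRat_sem (i : tw_pos rho) (J : nat_itv) (n : nat)
    (satS : tw_pos rho -> 'I_n -> Prop) (e : regexp 'I_n)
    (satphi : tw_pos rho -> Prop) : Prop :=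
  exists j : tw_pos rho,
    [/\ (i < j)%N, satphi j, tw_time j - tw_time i \in itv_of R J
      & segment_in (fun k => (i < k < j)%N) satS e].

Definition Rat_sem (i : tw_pos rho) (J : nat_itv) (n : nat)
    (satS : tw_pos rho -> 'I_n -> Prop) (e : regexp 'I_n) : Prop :=
  segment_in (fun k => tw_time k - tw_time i \in itv_of R J) satS e.

(* [satphi V i] stands for the satisfaction of the body at [i] under [V]. *)
Definition is_fixpoint (z : Z) (satphi : labelling -> tw_pos rho -> Prop)
    (V V' : labelling) : Prop :=
  (forall i, V' i :\ z = V i :\ z) /\
  (forall i, satphi V' i <-> z \in V' i).

Definition is_least_fixpoint (z : Z)
    (satphi : labelling -> tw_pos rho -> Prop) (V V' : labelling) : Prop :=
  is_fixpoint z satphi V V' /\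
  forall W, is_fixpoint z satphi V W -> forall i, z \in V' i -> z \in W i.

Definition is_greatest_fixpoint (z : Z)
    (satphi : labelling -> tw_pos rho -> Prop) (V V' : labelling) : Prop :=
  is_fixpoint z satphi V V' /\
  forall W, is_fixpoint z satphi V W -> forall i, z \in W i -> z \in V' i.

Fixpoint sat (phi : formula Sigma Z) (V : labelling) (i : tw_pos rho) : Prop :=
  match phi with
  | FProp a => a \in val (tw_sym i)
  | FTrue => True
  | FVar z => z \in V i
  | FAnd phi1 phi2 => sat phi1 V i /\ sat phi2 V i
  | FNot phi1 => ~ sat phi1 V i
  | FRatI J _ fs e => Rat_sem i J (fun k s => sat (fs s) V k) e
  | FFRat J _ fs e phi1 =>
      FRat_sem i J (fun k s => sat (fs s) V k) e (sat phi1 V)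
  | FGRat J _ fs e phi1 =>
      ~ FRat_sem i J (fun k s => sat (fs s) V k) e (fun j => ~ sat phi1 V j)
  | FMu z phi1 =>
      exists2 V', is_least_fixpoint z (sat phi1) V V' & z \in V' i
  | FNu z phi1 =>
      exists2 V', is_greatest_fixpoint z (sat phi1) V V' & z \in V' i
  end.

End Semantics.

(* A timed word without recursion variables is the super structure whose labels
   are all empty. *)
Definition models (R : realType) (Sigma Z : finType)
    (rho : timed_word R (letter Sigma)) (psi : formula Sigma Z) : Prop :=
  sat psi (fun _ : tw_pos rho => set0) ord0.

(* Main.v *)
Require Import Defs.
From HB Require Import structures.
From mathcomp Require Import all_boot all_order all_algebra finmap reals.
From mathcomp Require Import boolp.

(**
Every recursion variable Z_q stands for "location q accepts from here on if the
clock is reset here". Between two resets the clock of a copy started at position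
j has the value t_k - t_j at position k, so whether Z_q holds at j depends on the
later letters, on the values of the variables Z_p at later positions (they answer
the atoms x.p) and on the clock regions, through a finite automaton.

(a) Within one clock region that automaton is deterministic when read backward,
its states being the sets of accepting locations. Regions follow each other in
time, so one Rat_I formula per region, with I the region, describes the whole
run; the regular expressions come from Kleene's theorem.

(b) In a C+D automaton, complementing the conjunctive locations makes every
reset-free run a single path, which ends by a successful clock test or at the end
of the word; both cases are FRat formulas.

As all equations for the Z_q are guarded and words are finite, the system has
exactly one solution, and nested fixpoints define it.
*)

Set Implicit Arguments.
Unset Strict Implicit.
Unset Printing Implicit Defensive.

Import Order.TTheory GRing.Theory Num.Theory.

Local Open Scope ring_scope.

(** * Regular expressions for walks in a finite graph *)

Section RegexpLang.
Variable S : Type.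
Implicit Types (e : regexp S) (w : seq S).

Lemma re_lang_empty w : ~ re_lang ReEmpty w.
Proof. by move=> h; inversion h. Qed.

Lemma re_lang_eps w : re_lang ReEps w <-> w = [::].
Proof. by split=> [h|->]; [inversion h | constructor]. Qed.

Lemma re_lang_atom s w : re_lang (ReAtom s) w <-> w = [:: s].
Proof. by split=> [h|->]; [inversion h | constructor]. Qed.

Lemma re_lang_alt e1 e2 w :
  re_lang (ReAlt e1 e2) w <-> re_lang e1 w \/ re_lang e2 w.
Proof.
split=> [h|[h|h]]; last by [apply: LAltR]; last by apply: LAltL.
by inversion h; [left | right].
Qed.

Lemma re_lang_cat e1 e2 w :
  re_lang (ReCat e1 e2) w <->
  exists w1 w2, [/\ w = w1 ++ w2, re_lang e1 w1 & re_lang e2 w2].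
Proof.
split=> [h|[w1 [w2 [-> h1 h2]]]]; last exact: LCat.
by inversion h; exists w1, w2.
Qed.

Lemma re_lang_star_ind (P : seq S -> Prop) e : P [::] ->
  (forall w1 w2, re_lang e w1 -> P w2 -> P (w1 ++ w2)) ->
  forall w, re_lang (ReStar e) w -> P w.
Proof.
move=> P0 PS w; move eqe': (ReStar e) => e' h.
elim: h eqe' => // e1 w1 w2 h1 _ _ IH [ee]; subst e1.
by apply: PS => //; apply: IH.
Qed.

Lemma re_lang_alts (T : eqType) (f : T -> regexp S) (s : seq T) w :
  re_lang (foldr (@ReAlt _) ReEmpty [seq f x | x <- s]) w <->
  exists2 x, x \in s & re_lang (f x) w.
Proof.
elim: s => [|x s IH] /=; first by split=> [/re_lang_empty|[]].
rewrite re_lang_alt IH; split=> [[h|[y ys h]]|[y]].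
- by exists x; rewrite ?mem_head.
- by exists y; rewrite ?inE ?ys ?orbT.
- by rewrite inE => /orP[/eqP ->|ys h]; [left | right; exists y].
Qed.

End RegexpLang.

Section Walk.
Variables (L : Type) (V : finType) (E : V -> L -> V -> bool).

Fixpoint walk (u : V) (w : seq L) (v : V) : bool :=
  if w is l :: w' then [exists y, E u l y && walk y w' v] else u == v.

Lemma walk_cat u w1 w2 v :
  walk u (w1 ++ w2) v = [exists x, walk u w1 x && walk x w2 v].
Proof.
elim: w1 u => [|l w1 IH] u /=.
  apply/idP/existsP => [h|[x /andP[/eqP-> //]]].
  by exists u; rewrite eqxx.
apply/existsP/existsP => [[y]|[x /andP[/existsP[y /andP[uy yx]] xv]]].
  rewrite IH => /andP[uy /existsP[x /andP[yx xv]]]; exists x.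
  by rewrite xv andbT; apply/existsP; exists y; rewrite uy.
by exists y; rewrite uy IH; apply/existsP; exists x; rewrite yx.
Qed.

Lemma walk1 u l v : walk u [:: l] v = E u l v.
Proof.
by apply/existsP/idP => [[y /andP[? /eqP<-]]//|h]; exists v; rewrite h eqxx.
Qed.

End Walk.

Section Kleene.
Variables (L V : finType) (E : V -> L -> V -> bool).

(** Kleene's construction: [vs] lists the vertices allowed strictly inside a walk. Letters are
    encoded by [enum_rank] because expressions below a modality range over ['I_n]. *)
Fixpoint path_re (vs : seq V) (u v : V) : regexp 'I_#|L| :=
  if vs is x :: vs' then
    ReAlt (path_re vs' u v)
      (ReCat (path_re vs' u x)
         (ReCat (ReStar (path_re vs' x x)) (path_re vs' x v)))
  else ReAlt (if u == v then ReEps else ReEmpty)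
         (foldr (@ReAlt _) ReEmpty
            [seq ReAtom (enum_rank l) | l <- [seq l <- enum L | E u l v]]).

Definition walk_re := path_re (enum V).

Lemma path_re_walk vs u v w :
  re_lang (path_re vs u v) w -> walk E u (map enum_val w) v.
Proof.
elim: vs u v w => [|x vs IH] u v w /=; rewrite re_lang_alt.
  case=> [|/re_lang_alts[l]].
    by case: eqP => [-> /re_lang_eps->|_ /re_lang_empty]; rewrite /= ?eqxx.
  rewrite mem_filter => /andP[uv _] /re_lang_atom->.
  by rewrite [map _ _]/= walk1 enum_rankK.
case=> [/IH //|/re_lang_cat[w1 [w0 [-> /IH ux /re_lang_cat]]]].
case=> [w2 [w3 [{w0}-> xx /IH xv]]].
rewrite map_cat walk_cat; apply/existsP; exists x; rewrite ux /= {w ux}.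
move: w2 xx.
(* Keeping [w3] in the predicate lets every iteration of the star just prepend a loop at [x]. *)
apply: (@re_lang_star_ind _
  (fun w => walk E x (map enum_val (w ++ w3)) v)) => //.
move=> w w2 /IH xx h.
by rewrite -catA map_cat walk_cat; apply/existsP; exists x; rewrite xx.
Qed.

Lemma path_re_edge vs u l v :
  E u l v -> re_lang (path_re vs u v) [:: enum_rank l].
Proof.
move=> uv; elim: vs => [|x vs IH]; last exact: LAltL.
apply/LAltR/re_lang_alts; exists l; last by constructor.
by rewrite mem_filter uv mem_enum.
Qed.

(** This replaces the usual splitting of a walk at its visits to [x]: completeness then follows by
    prepending one letter at a time. *)
Lemma path_re_cons vs u l y v w : E u l y -> y \in vs ->
  re_lang (path_re vs y v) w -> re_lang (path_re vs u v) (enum_rank l :: w).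
Proof.
move=> uy; elim: vs y v w uy => // x vs IH y v w uy yvs.
move=> /= /re_lang_alt[h|/re_lang_cat[w1 [w0 [-> yx /re_lang_cat]]]].
  have [yvs'|/negbTE nyvs] := boolP (y \in vs); first exact/LAltL/(IH y).
  move: yvs uy h; rewrite inE nyvs orbF => /eqP-> uy h.
  apply/LAltR/(@LCat _ _ _ [:: _]); first exact: path_re_edge.
  by rewrite -[w]cat0s; apply: LCat => //; apply: LStarNil.
case=> [w2 [w3 [{w0}-> xx xv]]]; apply: LAltR.
have [yvs'|/negbTE nyvs] := boolP (y \in vs).
  by rewrite -cat_cons; apply: LCat; [apply: (IH y) | apply: LCat].
(* Here [y] is [x], so the loop read by [w1] becomes one more iteration of the star. *)
move: yvs uy yx; rewrite inE nyvs orbF => /eqP-> uy yx.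
apply: (@LCat _ _ _ [:: _]); first exact: path_re_edge.
by rewrite catA; apply: LCat => //; apply: LStarCat.
Qed.

Lemma walk_reP u v w :
  re_lang (walk_re u v) w <-> walk E u (map enum_val w) v.
Proof.
split=> [|]; first exact: path_re_walk.
elim: w u => [|i w IH] u /=.
  move=> /eqP->; rewrite /walk_re; elim: (enum V) => [|x vs IHv].
    by apply: LAltL; rewrite eqxx; constructor.
  exact: LAltL.
move=> /existsP[y /andP[uy /IH]]; rewrite -[i]enum_valK.
by apply: path_re_cons; rewrite ?mem_enum.
Qed.

End Kleene.

(** * Positions of a timed word *)

Section Positions.
Variables (R : realType) (A : Type) (rho : timed_word R A).
Implicit Types (P : pred (tw_pos rho)) (i j k l : tw_pos rho).

Definition positions P : seq (tw_pos rho) :=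
  [seq k <- enum 'I_(tw_last rho).+1 | P k].

Lemma pos_ind_down (P : tw_pos rho -> Prop) :
  (forall j, (forall k, (j < k)%N -> P k) -> P j) -> forall j, P j.
Proof.
move=> step j; have [m] := ubnP (tw_last rho - j)%N.
elim: m j => // m IH j jm; apply: step => k jk; apply: IH.
have := ltn_ord k; rewrite ltnS => kL.
by apply: leq_trans (ltn_sub2l (leq_trans jk kL) jk) _.
Qed.

Lemma mem_positions P k : (k \in positions P) = P k.
Proof. by rewrite mem_filter mem_enum andbT. Qed.

Lemma pairwise_positions P : pairwise (fun i j => i < j)%N (positions P).
Proof.
rewrite -sorted_pairwise => [|k i j]; last exact: ltn_trans.
apply: sorted_filter => [k i j|]; first exact: ltn_trans.
by have := iota_ltn_sorted 0 (tw_last rho).+1; rewrite -val_enum_ord sorted_map.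
Qed.

(** A strictly increasing list is determined by its members, so the decompositions of position lists
    below reduce to comparing members. *)
Lemma positions_unique P (s : seq (tw_pos rho)) :
  pairwise (fun i j => i < j)%N s -> s =i P -> s = positions P.
Proof.
have tr : transitive (fun i j : tw_pos rho => i < j)%N.
  by move=> k i j; apply: ltn_trans.
move=> ss sP; apply: (irr_sorted_eq tr) => [k|||k]; first exact: ltnn.
- by rewrite sorted_pairwise.
- by rewrite sorted_pairwise // pairwise_positions.
- by rewrite sP mem_positions.
Qed.

Lemma positions_cat P P1 P2 : (forall k, P k = P1 k || P2 k) ->
  (forall k l, P1 k -> P2 l -> (k < l)%N) ->
  positions P = positions P1 ++ positions P2.
Proof.
move=> eqP lt12; apply/esym/positions_unique => [|k].
  rewrite pairwise_cat !pairwise_positions !andbT.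
  by apply/allrelP => k l; rewrite !mem_positions; apply: lt12.
by rewrite mem_cat !mem_positions -eqP.
Qed.

Lemma eq_positions P1 P2 : P1 =1 P2 -> positions P1 = positions P2.
Proof. by move=> eq12; rewrite /positions (eq_filter eq12). Qed.

Lemma positions_cons P P' k : (forall l, P l = (l == k) || P' l) ->
  (forall l, P' l -> (k < l)%N) -> positions P = k :: positions P'.
Proof.
move=> eqP lt; apply/esym/positions_unique => [|l]; last first.
  by rewrite inE mem_positions -eqP.
rewrite /= pairwise_positions andbT; apply/allP => l.
by rewrite mem_positions; apply: lt.
Qed.

Lemma positions_nil P : (forall k, ~~ P k) -> positions P = [::].
Proof.
move=> nP; apply/esym/positions_unique => // k.
by rewrite in_nil; apply/esym/negbTE/nP.
Qed.

Lemma positions_split j k : (j < k)%N ->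
  positions (fun l => j < l)%N =
  positions (fun l => j < l < k)%N ++ k :: positions (fun l => k < l)%N.
Proof.
move=> jk; rewrite -(@positions_cons (fun l => k <= l)%N) => [|l|l] //.
  apply: positions_cat => [l|l l' /andP[_ lk]]; last exact: leq_trans.
  by case: (ltnP l k) => kl; rewrite ?andbT ?orbF // andbF (leq_trans jk).
by rewrite leq_eqVlt eq_sym.
Qed.

Lemma tw_time_le i j : (i <= j)%N -> tw_time i <= tw_time j.
Proof.
case: j => m; elim: m => [|m IH] lt_m ij.
  by rewrite le_eqVlt; apply/orP; left; apply/eqP; congr tw_time;
     apply/val_inj/eqP; rewrite /= -leqn0.
move: ij; rewrite leq_eqVlt => /orP[/eqP eqi|].
  by rewrite le_eqVlt; apply/orP; left; apply/eqP; congr tw_time; apply/val_inj.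
rewrite ltnS => im; apply: le_trans (IH (ltnW lt_m) im) _.
exact: tw_timeS.
Qed.

Lemma tw_time_lt i j : tw_time i < tw_time j -> (i < j)%N.
Proof. by apply: contraTT; rewrite -leqNgt -leNgt => /tw_time_le. Qed.

End Positions.

(** * Formulas *)

HB.instance Definition _ (Sigma : finType) := Finite.copy (letter Sigma)
  {a : {set Sigma} | a != set0}.

Section FormulaCombinators.
Variables Sigma Z : finType.
Local Notation form := (formula Sigma Z).

(* [b] requires in addition that the modality Rat_I does not occur. *)
Definition well_formed (b : bool) (S : {set Z}) (phi : form) : Prop :=
  [/\ free_vars phi \subset S, guarded phi & b -> Rat_free phi].

Definition ands (I : Type) (s : seq I) (g : I -> form) : form :=
  foldr (fun x phi => FAnd (g x) phi) (@FTrue _ _) s.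

Definition ors (I : Type) (s : seq I) (g : I -> form) : form :=
  FNot (ands s (fun x => FNot (g x))).

Lemma well_formed_true b S : well_formed b S (@FTrue _ _).
Proof. by split=> //=; rewrite sub0set. Qed.

Lemma well_formed_and b S phi1 phi2 :
  well_formed b S phi1 -> well_formed b S phi2 ->
  well_formed b S (FAnd phi1 phi2).
Proof.
case=> [a1 b1 c1] [a2 b2 c2]; split=> //=; first by rewrite subUset a1.
by move=> bT; split; [apply: c1 | apply: c2].
Qed.

Lemma well_formed_not b S phi :
  well_formed b S phi -> well_formed b S (FNot phi).
Proof. by []. Qed.

Lemma well_formed_ands b S (I : Type) (s : seq I) g :
  (forall x, well_formed b S (g x)) -> well_formed b S (ands s g).
Proof.
move=> h; elim: s => [|x s IH] /=; first exact: well_formed_true.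
exact: well_formed_and.
Qed.

Lemma well_formed_ors b S (I : Type) (s : seq I) g :
  (forall x, well_formed b S (g x)) -> well_formed b S (ors s g).
Proof. by move=> h; apply/well_formed_not/well_formed_ands. Qed.

Lemma var_guarded_ands z (I : Type) (s : seq I) g :
  (forall x, var_guarded z (g x)) -> var_guarded z (ands s g).
Proof. by move=> h; elim: s => [|x s IH] //=. Qed.

Lemma var_guarded_ors z (I : Type) (s : seq I) g :
  (forall x, var_guarded z (g x)) -> var_guarded z (ors s g).
Proof. by move=> h; apply: var_guarded_ands. Qed.

Section Letters.
Variable f : Z -> form.
Local Notation alphabet := (letter Sigma * {set Z})%type.

(** Exactly one of these formulas holds at each position, so the choices made under a rational
    modality are forced. Arbitrary formulas [f z] stand in for the variables because the equations
    are later instantiated with fixpoint formulas. *)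
Definition is_letter (l : alphabet) : form :=
  FAnd (ands (enum Sigma) (fun x => if x \in val l.1 then @FProp Sigma Z x
                                    else FNot (@FProp Sigma Z x)))
       (ands (enum Z) (fun z => if z \in l.2 then f z else FNot (f z))).

Definition frat (J : nat_itv) (V : finType) (E : V -> alphabet -> V -> bool)
    (u v : V) (phi : form) : form :=
  @FFRat _ _ J #|{: alphabet}| (fun s => is_letter (enum_val s))
    (walk_re E u v) phi.

Definition rati (J : nat_itv) (V : finType) (E : V -> alphabet -> V -> bool)
    (u v : V) : form :=
  @FRatI _ _ J #|{: alphabet}| (fun s => is_letter (enum_val s))
    (walk_re E u v).

(** The one-vertex graph with all loops accepts every word, so this FRat only asks for some later
    position at a distance in [J]. *)
Definition none_later (J : nat_itv) : form :=
  FNot (frat J (fun (_ : unit) _ _ => true) tt tt (@FTrue _ _)).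

Section WellFormed.
Variables (b : bool) (S : {set Z}).
Hypothesis wf_f : forall z, well_formed b S (f z).

Lemma well_formed_is_letter l : well_formed b S (is_letter l).
Proof.
apply: well_formed_and; apply: well_formed_ands => x.
  by case: ifP => _; split=> //=; rewrite sub0set.
by case: ifP => _ //; apply: well_formed_not.
Qed.

Lemma well_formed_frat J (V : finType) (E : V -> alphabet -> V -> bool)
    u v phi :
  well_formed b S phi -> well_formed b S (frat J E u v phi).
Proof.
case=> [a1 b1 c1]; split=> /=.
- rewrite subUset a1 andbT; apply/bigcupsP => s _.
  by case: (well_formed_is_letter (enum_val s)).
- by split=> // s; case: (well_formed_is_letter (enum_val s)).
- move=> bT; split=> [s|]; last exact: c1.
  by case: (well_formed_is_letter (enum_val s)) => _ _; apply.
Qed.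

Lemma well_formed_rati J (V : finType) (E : V -> alphabet -> V -> bool) u v :
  b = false -> well_formed b S (rati J E u v).
Proof.
move=> bF; split=> /=; last by rewrite bF.
  by apply/bigcupsP => s _; case: (well_formed_is_letter (enum_val s)).
by move=> s; case: (well_formed_is_letter (enum_val s)).
Qed.

Lemma well_formed_none_later J : well_formed b S (none_later J).
Proof. exact/well_formed_not/well_formed_frat/well_formed_true. Qed.

End WellFormed.

Section Sat.
Variables (R : realType) (rho : timed_word R (letter Sigma)).
Implicit Types (V : labelling Z rho) (i j k : tw_pos rho).

Lemma sat_and phi1 phi2 V i :
  sat (FAnd phi1 phi2) V i <-> sat phi1 V i /\ sat phi2 V i.
Proof. by []. Qed.

Lemma sat_not phi V i : sat (FNot phi) V i <-> ~ sat phi V i.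
Proof. by []. Qed.

Lemma sat_ands (I : eqType) (s : seq I) g V i :
  sat (ands s g) V i <-> forall x, x \in s -> sat (g x) V i.
Proof.
elim: s => [|x s IH] //=; rewrite IH; split=> [[h1 h2] y|h].
  by rewrite inE => /orP[/eqP-> //|]; apply: h2.
split=> [|y ys]; apply: h; first exact: mem_head.
by rewrite inE ys orbT.
Qed.

Lemma sat_ors (I : eqType) (s : seq I) g V i :
  sat (ors s g) V i <-> exists2 x, x \in s & sat (g x) V i.
Proof.
rewrite /ors /= sat_ands /=; split=> [h|[x xs h] h']; last exact: h' xs h.
by apply: contrapT => h'; apply: h => x xs hx; apply: h'; exists x.
Qed.

Definition label V k : {set Z} := [set z | `[< sat (f z) V k >]].

Definition letter_at V k : alphabet := (tw_sym k, label V k).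

Lemma sat_is_letter l V k : sat (is_letter l) V k <-> l = letter_at V k.
Proof.
case: l => a X; rewrite /is_letter /= !sat_ands /=; split=> [[ha hX]|[-> ->]].
  congr pair.
    apply/val_inj/setP => x; have := ha x; rewrite mem_enum => /(_ isT).
    by case: ifP => /= _; [move=> -> | move/negP/negbTE].
  apply/setP => z; have := hX z; rewrite mem_enum => /(_ isT).
  by rewrite inE; case: ifP => _ h; apply/esym/asboolP.
split=> x _; first by case: ifP => // /negbT /negP.
by rewrite inE; case: asboolP.
Qed.

(** Since the [is_letter] formulas exclude each other, the only word that can be chosen is the word
    of actual letters. *)
Lemma segment_in_walk_re (V : labelling Z rho) (P : pred (tw_pos rho))
    (W : finType) (E : W -> alphabet -> W -> bool) u v :
  segment_in P
    (fun k (s : 'I_#|{: alphabet}|) => sat (is_letter (enum_val s)) V k)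
    (walk_re E u v) <->
  walk E u [seq letter_at V k | k <- positions P] v.
Proof.
split=> [[w [eqw /walk_reP h hw]]|h].
  move: h; rewrite /positions -eqw /unzip1 /unzip2 -!map_comp.
  congr (walk E u _ v); apply/eq_in_map => c /hw /sat_is_letter.
  by [].
exists [seq (k, enum_rank (letter_at V k)) | k <- positions P].
rewrite /unzip1 /unzip2 -!map_comp; split.
- by rewrite -[RHS]map_id; apply: eq_map.
- apply/walk_reP; rewrite -map_comp; move: h; congr (walk E u _ v).
  by apply: eq_map => k /=; rewrite enum_rankK.
- by move=> _ /mapP[k _ ->] /=; apply/sat_is_letter; rewrite enum_rankK.
Qed.

Lemma sat_frat J (W : finType) (E : W -> alphabet -> W -> bool) u v phi V j :
  sat (frat J E u v phi) V j <->
  exists k, [/\ (j < k)%N, sat phi V k, tw_time k - tw_time j \in itv_of R J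
   & walk E u [seq letter_at V l | l <- positions (fun l => j < l < k)%N] v].
Proof.
by split=> -[k [h1 h2 h3 h4]]; exists k; split=> //; apply/segment_in_walk_re.
Qed.

Lemma sat_rati J (W : finType) (E : W -> alphabet -> W -> bool) u v V j :
  sat (rati J E u v) V j <->
  walk E u [seq letter_at V k
           | k <- positions (fun k => tw_time k - tw_time j \in itv_of R J)] v.
Proof. exact: segment_in_walk_re. Qed.

Lemma sat_none_later J V j :
  sat (none_later J) V j <->
  forall k, (j < k)%N -> tw_time k - tw_time j \notin itv_of R J.
Proof.
rewrite /none_later sat_not; split=> [h k jk|h /sat_frat[k [jk _ kJ _]]].
  apply/negP => kJ; apply: h; apply/sat_frat; exists k; split=> //.
  elim: (map _ _) => //= l w IH; apply/existsP; by exists tt.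
by move: (h k jk); rewrite kJ.
Qed.

End Sat.
End Letters.
End FormulaCombinators.

(** * Intervals for clock regions *)

Definition point_itv (c : nat) : nat_itv := NatItv true c (Some (true, c)).
Definition open_itv (c : nat) : nat_itv := NatItv false c (Some (false, c.+1)).
Definition above_itv (c : nat) : nat_itv := NatItv false c None.
Definition full_itv : nat_itv := NatItv true 0 None.

Lemma in_point_itv (R : realDomainType) (v : R) c :
  (v \in itv_of R (point_itv c)) = (v == c%:R).
Proof. by rewrite in_itv /= eq_le andbC. Qed.

Lemma in_open_itv (R : realDomainType) (v : R) c :
  (v \in itv_of R (open_itv c)) = (c%:R < v < c.+1%:R).
Proof. by rewrite in_itv. Qed.

Lemma in_above_itv (R : realDomainType) (v : R) c :
  (v \in itv_of R (above_itv c)) = (c%:R < v).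
Proof. by rewrite in_itv /= andbT. Qed.

Lemma in_full_itv (R : realDomainType) (v : R) :
  (v \in itv_of R full_itv) = (0 <= v).
Proof. by rewrite in_itv /= andbT. Qed.

Section Disjunction.
Variables Sigma Z : finType.
Implicit Types phi : formula Sigma Z.

Definition disj phi1 phi2 := FNot (FAnd (FNot phi1) (FNot phi2)).

Lemma well_formed_disj b S phi1 phi2 : well_formed b S phi1 ->
  well_formed b S phi2 -> well_formed b S (disj phi1 phi2).
Proof. by move=> h1 h2; apply/well_formed_not/well_formed_and. Qed.

Lemma sat_disj (R : realType) (rho : timed_word R (letter Sigma))
    (V : labelling Z rho) i phi1 phi2 :
  sat (disj phi1 phi2) V i <-> sat phi1 V i \/ sat phi2 V i.
Proof.
rewrite /=; split=> [h|[h1|h2] []//].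
by apply: contrapT => /not_orP.
Qed.

End Disjunction.

(** * Reading all later positions at a distance in a given interval *)

Section WalkThrough.
Variables (Sigma Z : finType) (f : Z -> formula Sigma Z).
Variables (J : nat_itv) (W : finType).
Variable E : W -> letter Sigma * {set Z} -> W -> bool.

(* For [J] = [0,0], Rat_J cannot be used instead: it also sees the current
   position and the earlier ones with the same time stamp. *)
Definition walk_through (u v : W) : formula Sigma Z :=
  disj (FAnd (if u == v then @FTrue _ _ else FNot (@FTrue _ _))
             (none_later f J))
       (ors [seq xl : W * (letter Sigma * {set Z})
                 <- enum {: W * (letter Sigma * {set Z})} | E xl.1 xl.2 v]
            (fun xl => frat f J E u xl.1
                         (FAnd (is_letter f xl.2) (none_later f J)))).

Lemma well_formed_walk_through b S u v :
  (forall z, well_formed b S (f z)) -> well_formed b S (walk_through u v).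
Proof.
move=> wf_f; apply: well_formed_disj.
  apply: well_formed_and; last exact: well_formed_none_later.
  by case: ifP => _; [| apply: well_formed_not]; apply: well_formed_true.
apply: well_formed_ors => xl; apply: well_formed_frat => //.
apply: well_formed_and; first exact: well_formed_is_letter.
exact: well_formed_none_later.
Qed.

Lemma var_guarded_walk_through z u v : var_guarded z (walk_through u v).
Proof.
by split; [split=> //; case: ifP | apply: var_guarded_ors].
Qed.

Variables (R : realType) (rho : timed_word R (letter Sigma)).
Implicit Types (V : labelling Z rho) (j k l : tw_pos rho).
Hypothesis J_add : forall x y : R, 0 <= x -> 0 <= y ->
  (x + y \in itv_of R J) = (x \in itv_of R J) && (y \in itv_of R J).

(** By [J_add] a distance lies in [J] iff both of its parts do: positions between [j] and [k]
    inherit membership from [k], and positions after [k] inherit failure. *)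
Lemma positions_rcons_last j k :
  (j < k)%N -> tw_time k - tw_time j \in itv_of R J ->
  (forall l, (k < l)%N -> tw_time l - tw_time k \notin itv_of R J) ->
  positions (fun l => (j < l)%N && (tw_time l - tw_time j \in itv_of R J)) =
  rcons (positions (fun l => j < l < k)%N) k.
Proof.
have addJ (i l m : tw_pos rho) : (i <= l)%N -> (l <= m)%N ->
    (tw_time m - tw_time i \in itv_of R J) =
    (tw_time l - tw_time i \in itv_of R J) &&
    (tw_time m - tw_time l \in itv_of R J).
  move=> il lm; rewrite -J_add ?subr_ge0 ?tw_time_le //.
  by rewrite [X in _ = (X \in _)]addrC addrA subrK.
move=> jk tk later; rewrite -cats1.
rewrite -[[:: k]](_ : positions (pred1 k) = _); last first.
  rewrite (@positions_cons _ _ _ _ pred0 k) //; last by move=> l; rewrite orbF.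
  by rewrite positions_nil.
apply: positions_cat => [l|l l' /andP[_ lk] /eqP-> //].
rewrite /=; case: (ltngtP l k) => [lk|kl|/val_inj->];
  last by rewrite jk tk !eqxx.
  rewrite andbT (_ : l == k = false) ?orbF; last first.
    by apply/negbTE; apply: contraTneq lk => ->; rewrite ltnn.
  case: ltnP => //= jl.
  by move: tk; rewrite (addJ _ _ _ (ltnW jl) (ltnW lk)) => /andP[].
rewrite (addJ _ _ _ (ltnW jk) (ltnW kl)) (negbTE (later l kl)) !andbF.
by apply/esym/negbTE; apply: contraTneq kl => ->; rewrite ltnn.
Qed.

(** The word read by FRat stops before its target [k], so the formula guesses the vertex [x] reached
    there and the letter at [k]; [none_later] at [k] makes [k] the last relevant position. *)
Lemma sat_walk_through u v V j :
  sat (walk_through u v) V j <->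
  walk E u [seq letter_at f V k | k <- positions (fun k =>
     (j < k)%N && (tw_time k - tw_time j \in itv_of R J))] v.
Proof.
rewrite sat_disj sat_and sat_ors sat_none_later; split.
  case=> [[]|[[x l]]].
    case: eqP => //= -> _ later.
    rewrite positions_nil => [|k]; first exact: eqxx.
    by case: ltnP => //= /later.
  rewrite mem_filter => /andP[xlv _] /sat_frat[k [jk]].
  rewrite sat_and sat_is_letter sat_none_later => -[el later] tk ux.
  rewrite (positions_rcons_last jk tk later) map_rcons -cats1 walk_cat.
  by apply/existsP; exists x; rewrite ux walk1 -el.
set P := fun k => (_ && _).
have [s] : exists s, s = positions P by eexists.
case/lastP: s => [|s k] /esym eqs.
  rewrite eqs => /eqP euv; left; split; first by rewrite euv eqxx.
  move=> k jk; apply/negP => tk.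
  by have := mem_positions P k; rewrite eqs /P jk tk.
have : P k by rewrite -mem_positions eqs mem_rcons mem_head.
case/andP=> jk tk.
have later (l : tw_pos rho) : (k < l)%N ->
    tw_time l - tw_time k \notin itv_of R J.
  move=> kl; apply/negP => tl; have := mem_positions P l.
  rewrite eqs /P (ltn_trans jk kl) mem_rcons inE.
  have -> : tw_time l - tw_time j =
            (tw_time k - tw_time j) + (tw_time l - tw_time k).
    by rewrite [RHS]addrC addrA subrK.
  rewrite J_add ?subr_ge0 ?tw_time_le ?(ltnW jk) ?(ltnW kl) // tk tl /=.
  move=> /orP[/eqP ekl|ls]; first by rewrite ekl ltnn in kl.
  have := pairwise_positions P; rewrite eqs -cats1 pairwise_cat.
  by rewrite allrel1r => /andP[/allP /(_ _ ls)]; rewrite ltnNge (ltnW kl).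
rewrite (positions_rcons_last jk tk later) map_rcons -cats1 walk_cat.
case/existsP=> x /andP[ux]; rewrite walk1 => xv.
right; exists (x, letter_at f V k); first by rewrite mem_filter mem_enum xv.
apply/sat_frat; exists k; split=> //.
by apply/sat_and; split; [apply/sat_is_letter | apply/sat_none_later].
Qed.

End WalkThrough.

(** * Guarded systems of equations *)

(* Nested fixpoints (Bekic) solve a system of mutually recursive guarded
   equations: [S] is the set of variables already bound by an outer fixpoint. *)
Section System.
Variables (Sigma Q : finType).
Variable phi : Q -> (Q -> formula Sigma Q) -> formula Sigma Q.

(** The fuel [n] bounds the number of variables outside [S]; under that bound the default [FTrue] is
    never reached. *)
Fixpoint solution (n : nat) (S : {set Q}) (q : Q) : formula Sigma Q :=
  if q \in S then @FVar Sigma Q q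
  else if n is n'.+1 then FMu q (phi q (solution n' (q |: S)))
  else @FTrue _ _.

Lemma well_formed_solution b n S q :
  (forall q f S, (forall p, well_formed b S (f p)) ->
     well_formed b S (phi q f)) ->
  (forall q f z, var_guarded z (phi q f)) ->
  well_formed b S (solution n S q).
Proof.
move=> wf_phi vg_phi; elim: n S q => [|n IH] S q /=; case: ifP => qS.
- by split=> //=; rewrite sub1set.
- exact: well_formed_true.
- by split=> //=; rewrite sub1set.
have [h1 h2 h3] := wf_phi q _ _ (IH (q |: S)).
by split=> //=; rewrite subDset.
Qed.

Variables (R : realType) (rho : timed_word R (letter Sigma)).
Implicit Types (V T : labelling Q rho) (S : {set Q}) (i j k : tw_pos rho).
Variable F : labelling Q rho -> labelling Q rho.
Hypothesis F_local : forall T1 T2 j,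
  (forall k, (j < k)%N -> T1 k = T2 k) -> F T1 j = F T2 j.
Hypothesis sat_phi : forall q f V j,
  sat (phi q f) V j <-> q \in F (label f V) j.

(** Variables in [S] are parameters read off [V]; only the others obey their equations. *)
Definition solves V S T := forall j, T j = (V j :&: S) :|: (F T j :\: S).

Lemma solves_unique V1 V2 S T1 T2 :
  (forall j, V1 j :&: S = V2 j :&: S) ->
  solves V1 S T1 -> solves V2 S T2 -> T1 =1 T2.
Proof.
move=> eqV sol1 sol2; apply: pos_ind_down => j IH.
by rewrite sol1 sol2 eqV (F_local IH).
Qed.

Lemma solves_exists V S : exists T, solves V S T.
Proof.
pose G T : labelling Q rho := fun j => (V j :&: S) :|: (F T j :\: S).
pose T m := iter m G (fun=> set0).
(* By locality the iterates settle from the last position backward, one position per round. *)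
have stable m j : (tw_last rho - j < m)%N -> T m.+1 j = T m j.
  elim: m j => // m IH j jm.
  rewrite -[LHS]/(G (T m.+1) j) -[RHS]/(G (T m) j) /G.
  congr (_ :|: (_ :\: _)); apply: F_local => k jk.
  apply: IH.
  have := ltn_ord k; rewrite ltnS => kL.
  by apply: leq_trans (ltn_sub2l (leq_trans jk kL) jk) _.
exists (T (tw_last rho).+1) => j.
by rewrite -[LHS]stable // ltnS leq_subr.
Qed.

(** Bekic's argument: moving [q] into [S] turns its equation into that of the fixpoint. This
    fixpoint is unique, hence least. *)
Lemma sat_solution n V S T q i : (#|~: S| <= n)%N -> solves V S T ->
  sat (solution n S q) V i <-> q \in T i.
Proof.
elim: n V S T q i => [|n IH] V S T q i /=.
  rewrite leqn0 cards_eq0 => /eqP S0 solT.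
  have qS : q \in S by rewrite -[S]setCK S0 setC0 inE.
  by rewrite qS /= solT !inE qS /= andbT orbF.
move=> Sn solT; case: ifPn => qS /=.
  by rewrite solT !inE qS /= andbT orbF.
have Sn' : (#|~: (q |: S)| <= n)%N.
  rewrite -ltnS (leq_trans _ Sn) // setCU setIC.
  by rewrite -setDE [X in (_ < X)%N](cardsD1 q) inE qS.
have satW W T' k : solves W (q |: S) T' ->
    sat (phi q (solution n (q |: S))) W k <-> q \in F T' k.
  move=> solT'; rewrite sat_phi.
  suff -> : label (solution n (q |: S)) W = T' by [].
  apply/funext => l; apply/setP => p; rewrite inE.
  by apply/asboolP/idP => /IH; apply.
pose V' : labelling Q rho := fun k => if q \in T k then q |: V k else V k :\ q.
have V'q k p : p \in V' k = if p == q then q \in T k else p \in V k.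
  by rewrite /V'; case: ifP => qT; rewrite !inE; case: eqP => // ->.
have solV' : solves V' (q |: S) T.
  move=> k; apply/setP => p; rewrite !inE V'q [in LHS]solT !inE.
  by case: eqVneq => [->|_] /=;
    rewrite ?(negbTE qS) ?andbF //= solT !inE (negbTE qS) ?andbF ?andbT ?orbF.
have qT k : q \in T k = (q \in F T k) by rewrite solT !inE (negbTE qS) andbF.
have fixV' : is_fixpoint q (sat (phi q (solution n (q |: S)))) V V'.
  split=> k; last by rewrite (satW _ _ _ solV') V'q eqxx qT.
  by apply/setP => p; rewrite !inE V'q; case: eqP.
(* Given a fixpoint [W], the solution [T'] with parameter [q] read off [W] also satisfies the
   equation of [q], so it solves the system for [S] and equals [T]. *)
have uniqV' W : is_fixpoint q (sat (phi q (solution n (q |: S)))) V W ->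
    forall k, (q \in W k) = (q \in T k).
  move=> [agree fixW]; have [T' solT'] := solves_exists W (q |: S).
  have VW k p : p != q -> (p \in W k) = (p \in V k).
    by move=> pq; have /setP/(_ p) := agree k; rewrite !inE pq.
  have qW k : (q \in W k) = (q \in T' k).
    by rewrite solT' !inE eqxx /= andbT orbF.
  suff eqT : T' =1 T by move=> k; rewrite qW eqT.
  apply: (solves_unique (V1 := V) (V2 := V) (S := S)) => // k.
  apply/setP => p; rewrite !inE.
  have [->|pq] := eqVneq p q.
    rewrite (negbTE qS) andbF /= -qW; apply/idP/idP => h.
      by rewrite -(satW W) //; apply/fixW.
    by apply/fixW/(satW W).
  by rewrite [in LHS]solT' !inE (negbTE pq) /= VW.
split=> [[W [fixW _] qW]|qTi]; first by rewrite -(uniqV' W).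
exists V'; last by rewrite V'q eqxx.
by split=> // W fixW k; rewrite V'q eqxx (uniqV' W).
Qed.

End System.

(** * Backward evaluation of alternating automata *)

Section Acceptance.
Variables (R : realType) (Sigma : finType) (M : ata (letter Sigma)).
Local Notation Q := (ata_loc M).
Implicit Types (rho : timed_word R (letter Sigma)).

Lemma tcond_sat_mono (v : R) (X Y : {set Q + Q}) phi : X \subset Y ->
  tcond_sat v X phi -> tcond_sat v Y phi.
Proof.
move=> /subsetP XY; elim: phi => //=.
- by move=> p1 IH1 p2 IH2 /andP[/IH1-> /IH2->].
- by move=> p1 IH1 p2 IH2 /orP[/IH1->|/IH2->]; rewrite ?orbT.
- by move=> q /XY.
- by move=> q /XY.
Qed.

(** Copies of an alternating automaton evolve independently, so one copy is evaluated at a time,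
    choosing all accepting targets; by monotonicity this choice is the best. *)
Fixpoint accepts_from (w : seq (letter Sigma * R)) (c : Q * R) : bool :=
  if w is (a, d) :: w' then
    tcond_sat (c.2 + d) [set x | accepts_from w' (target (c.2 + d) x)]
      (ata_trans c.1 a)
  else c.1 \in ata_final M.

Definition delays rho : seq (letter Sigma * R) :=
  [seq (tw_sym i, tw_time i - prev_time i) | i <- enum 'I_(tw_last rho).+1].

Lemma drop_delays rho (k : tw_pos rho) :
  drop k (delays rho) =
  (tw_sym k, tw_time k - prev_time k) :: drop k.+1 (delays rho).
Proof.
have kn : (k < size (enum 'I_(tw_last rho).+1))%N by rewrite size_enum_ord.
rewrite /delays -[in LHS]map_drop -[in RHS]map_drop.
by rewrite (drop_nth ord0 kn) /= nth_ord_enum.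
Qed.

Lemma drop_delays_last rho n : (tw_last rho < n)%N ->
  drop n (delays rho) = [::].
Proof. by move=> h; apply: drop_oversize; rewrite size_map size_enum_ord. Qed.

Lemma ata_accepts_from rho :
  ata_accepts M rho <-> accepts_from (delays rho) (ata_init M, 0).
Proof.
split=> [[C [C0 runC] finC]|acc].
  (* Induction on the number [m] of letters still to be read. *)
  suff h m i : (i + m)%N = (tw_last rho).+1 -> forall c, c \in C i ->
      accepts_from (drop i (delays rho)) c.
    rewrite -[delays rho]drop0; apply: (h (tw_last rho).+1) => //.
    by rewrite C0 inE.
  elim: m i => [|m IH] i; rewrite ?addn0 => im c cC.
    by rewrite drop_delays_last ?im //; apply: finC; rewrite -im.
  have iL : (i < (tw_last rho).+1)%N by rewrite -im addnS ltnS leq_addr.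
  have [X [satX eqC]] := runC (Ordinal iL).
  rewrite (drop_delays (Ordinal iL)) /=.
  set d := tw_time _ - _ in satX eqC *.
  have cD : (c.1, c.2 + d) \in delay d (C i).
    by apply/imfsetP; exists c.
  apply: tcond_sat_mono (satX _ cD); apply/subsetP => x xX; rewrite inE.
  apply: IH; first by rewrite addSnnS.
  rewrite eqC; apply/bigfcupP; exists (c.1, c.2 + d); first by rewrite cD.
  by apply/imfsetP; exists x.
(* The run always chooses every accepting target, so all its copies accept the rest of the word. *)
pose choice i (c : Q * R) :=
  [set x | accepts_from (drop i (delays rho)) (target c.2 x)].
pose C := fix C i : config R M := if i is i'.+1 then
    let k : tw_pos rho := inord i' in
    (\bigcup_(c <- delay (tw_time k - prev_time k) (C i'))
       [fset target c.2 x | x in choice i c])%fset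
  else [fset (ata_init M, 0)]%fset.
have accC i c : c \in C i -> accepts_from (drop i (delays rho)) c.
  case: i => [|i] /=; first by rewrite inE drop0 => /eqP->.
  by case/bigfcupP => c' _ /imfsetP[x /=]; rewrite inE => h ->.
exists C => [|c /accC]; last by rewrite drop_delays_last.
split=> // i; exists (choice i.+1); split; last by rewrite /= inord_val.
move=> _ /imfsetP[c /= /accC h ->] /=.
by move: h; rewrite drop_delays.
Qed.

(* A clock reset at [j] is followed up with the clock value [t k - t j] at
   [k > j]; [l.2] and [T k] tell which locations accept after a reset at [k]. *)
Definition step (v : R) (l : letter Sigma * {set Q}) (B : {set Q}) : {set Q} :=
  [set q | tcond_sat v
     [set x | match x with inl p => p \in B | inr p => p \in l.2 end]
     (ata_trans q l.1)].

Definition backward rho (T : labelling Q rho) (j : tw_pos rho)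
    (s : seq (tw_pos rho)) : {set Q} :=
  foldr (fun k => step (tw_time k - tw_time j) (tw_sym k, T k))
    (ata_final M) s.

(** The right-hand side of the system of equations; it uses [T] only at positions after [j]. *)
Definition reset_value rho (T : labelling Q rho) : labelling Q rho :=
  fun j => backward T j (positions (fun k => j < k)%N).

Lemma reset_value_local rho (T1 T2 : labelling Q rho) (j : tw_pos rho) :
  (forall k : tw_pos rho, (j < k)%N -> T1 k = T2 k) ->
  reset_value T1 j = reset_value T2 j.
Proof.
move=> eqT; rewrite /reset_value /backward.
have : all (fun k : tw_pos rho => j < k)%N (positions (fun k => j < k)%N).
  by apply/allP => k; rewrite mem_positions.
by elim: (positions _) => //= k s IH /andP[jk /IH->]; rewrite eqT.
Qed.

Definition reset_accepts rho : labelling Q rho :=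
  fun j => [set p | accepts_from (drop j.+1 (delays rho)) (p, 0)].

Lemma reset_value_accepts rho (j : tw_pos rho) :
  reset_value (@reset_accepts rho) j = @reset_accepts rho j.
Proof.
(* Generalised from a fresh reset at [j] to a copy that has reached [k] with clock value
   [tw_time k - tw_time j]. *)
suff h (k : tw_pos rho) : forall q,
    accepts_from (drop k.+1 (delays rho)) (q, tw_time k - tw_time j) =
    (q \in backward (@reset_accepts rho) j (positions (fun l => k < l)%N)).
  by apply/setP => q; rewrite -h inE subrr.
elim/pos_ind_down: k => k IH q.
have [kL|Lk] := ltnP k (tw_last rho); last first.
  rewrite drop_delays_last // positions_nil // => l.
  by rewrite -leqNgt (leq_trans _ Lk) // -ltnS.
pose k' : tw_pos rho := Ordinal (kL : (k.+1 < (tw_last rho).+1)%N).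
have -> : positions (fun l : tw_pos rho => k < l)%N =
          k' :: positions (fun l => k' < l)%N.
  by apply: positions_cons => // l; rewrite leq_eqVlt eq_sym.
rewrite -[k.+1]/(nat_of_ord k') drop_delays /= inE /=.
have -> : tw_time k - tw_time j + (tw_time k' - prev_time k') =
          tw_time k' - tw_time j.
  rewrite /prev_time /= inord_val addrC addrA.
  by rewrite subrK.
congr (tcond_sat _ _ _); apply/setP => -[p|p]; rewrite !inE /=; first exact: IH.
by [].
Qed.

(** Common to both parts of the theorem: it remains to express [reset_value] by guarded formulas. *)
Lemma sentence_of_equations b
    (phi : Q -> (Q -> formula Sigma Q) -> formula Sigma Q) :
  (forall q f S, (forall p, well_formed b S (f p)) ->
     well_formed b S (phi q f)) ->
  (forall q f z, var_guarded z (phi q f)) ->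
  (forall rho q f (V : labelling Q rho) j,
     sat (phi q f) V j <-> q \in reset_value (label f V) j) ->
  exists psi : formula Sigma Q, well_formed b set0 psi /\
    forall rho, models rho psi <-> ata_accepts M rho.
Proof.
move=> wf_phi vg_phi sat_phi; pose f := solution phi #|Q| set0.
(* The first letter is read at time 0, where the clock is 0 with or without a reset; hence [l.2]
   answers both kinds of atoms. *)
exists (ors [seq l <- enum {: letter Sigma * {set Q}}
            | ata_init M \in step 0 l l.2] (is_letter f)); split.
  apply: well_formed_ors => l; apply: well_formed_is_letter => z.
  exact: well_formed_solution.
move=> rho; rewrite /models; set V := fun _ => set0.
have labelE : label f V ord0 = @reset_accepts rho ord0.
  apply/setP => p; rewrite inE; apply/asboolP/idP => /sat_solution; apply;
    try exact: reset_value_local; try exact: sat_phi;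
    by rewrite ?max_card // => j; rewrite setI0 set0U setD0 reset_value_accepts.
rewrite sat_ors ata_accepts_from -[delays rho]drop0.
rewrite (drop_delays (ord0 : tw_pos rho)) /= add0r /prev_time /= subr0 tw_time0.
transitivity (ata_init M \in step 0 (letter_at f V ord0) (label f V ord0)).
  split=> [[l]|h].
    by rewrite mem_filter => /andP[h _] /sat_is_letter el; rewrite el in h.
  exists (letter_at f V ord0); last exact/sat_is_letter.
  by rewrite mem_filter h mem_enum.
rewrite inE labelE /letter_at /= labelE.
by split; congr (tcond_sat _ _ _); apply/setP => -[p|p]; rewrite !inE.
Qed.

End Acceptance.

(** * Arbitrary automata *)

Fixpoint tcond_const (Q : Type) (phi : tcond Q) : nat :=
  match phi with
  | TAnd phi1 phi2 | TOr phi1 phi2 => maxn (tcond_const phi1) (tcond_const phi2)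
  | TClock J => maxn (itv_lo J) (if itv_hi J is Some (_, h) then h else 0)
  | _ => 0
  end.

Section GeneralCase.
Variables (R : realType) (Sigma : finType) (M : ata (letter Sigma)).
Local Notation Q := (ata_loc M).
Local Notation alphabet := (letter Sigma * {set Q})%type.
Implicit Types (rho : timed_word R (letter Sigma)) (A B C : {set Q}) (v : R).

(** Region equivalence for a single clock, where no order of fractional parts has to be tracked. *)
Definition same_region (m : nat) v1 v2 := forall c, (c <= m)%N ->
  (c%:R < v1) = (c%:R < v2) /\ (v1 < c%:R) = (v2 < c%:R).

Lemma tcond_sat_same_region m v1 v2 (X : {set Q + Q}) phi :
  same_region m v1 v2 -> (tcond_const phi <= m)%N ->
  tcond_sat v1 X phi = tcond_sat v2 X phi.
Proof.
move=> eqv; elim: phi => //= [p1 IH1 p2 IH2|p1 IH1 p2 IH2|J].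
- by rewrite geq_max => /andP[/IH1-> /IH2->].
- by rewrite geq_max => /andP[/IH1-> /IH2->].
case: J => cl lo hi /=; rewrite geq_max => /andP[/eqv[lo1 lo2] him].
have loE : Order.lteif lo%:R v1 cl = Order.lteif lo%:R v2 cl.
  by case: cl; rewrite /= ?lo1 // !leNgt lo2.
rewrite !in_itv /= loE; case: hi him => // -[ch h] /eqv[hi1 hi2].
by congr andb; case: ch; rewrite /= ?hi2 // !leNgt hi1.
Qed.

Definition max_const : nat :=
  \max_(p : Q * letter Sigma) tcond_const (ata_trans p.1 p.2).

Lemma step_same_region m v1 v2 l B : (max_const <= m)%N ->
  same_region m v1 v2 -> step v1 l B = step v2 l B.
Proof.
move=> cm eqv; apply/setP => q; rewrite !inE.
apply: tcond_sat_same_region eqv _; apply: leq_trans cm.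
exact: (@leq_bigmax _ (fun p => tcond_const (ata_trans p.1 p.2)) (q, l.1)).
Qed.

Lemma same_region_open m c v :
  c%:R < v < c.+1%:R -> same_region m v (c%:R + 2^-1).
Proof.
case/andP=> cv vc d _.
have h0 : (0 : R) < 2^-1 by rewrite invr_gt0.
have h1 : (2^-1 : R) < 1 by rewrite invf_lt1 // ltr1n.
have [dc|cd] := leqP d c.
  have dcR : d%:R <= c%:R :> R by rewrite ler_nat.
  have dv := le_lt_trans dcR cv.
  have dv' : d%:R < c%:R + 2^-1 :> R by apply: le_lt_trans dcR _; rewrite ltrDl.
  by rewrite dv dv' !ltNge !ltW.
have cdR : c.+1%:R <= d%:R :> R by rewrite ler_nat.
have vd := lt_le_trans vc cdR.
have vd' : c%:R + 2^-1 < d%:R :> R.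
  by apply: lt_le_trans cdR; rewrite -[c.+1]addn1 natrD ltrD2l.
by rewrite vd vd' !ltNge !ltW.
Qed.

Lemma same_region_above m c v : (m <= c)%N -> c%:R < v ->
  same_region m v c.+1%:R.
Proof.
move=> mc cv d dm; have dc := leq_trans dm mc.
have dv : d%:R < v by apply: le_lt_trans cv; rewrite ler_nat.
by rewrite dv !ltr_nat ltnS dc ltNge (ltW dv) ltnNge leqW.
Qed.

(* The automaton with a fixed clock region is deterministic when read from the
   end of the word; its states are the sets of accepting locations. *)
Definition edge v A (l : alphabet) B : bool := A == step v l B.

Lemma walk_edge v A w B : walk (edge v) A w B = (A == foldr (step v) B w).
Proof.
elim: w A => //= l w IH A; apply/existsP/eqP => [[C /andP[/eqP-> ]]|->].
  by rewrite IH => /eqP->.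
by exists (foldr (step v) B w); rewrite IH /edge !eqxx.
Qed.

Section Formulas.
Variable f : Q -> formula Sigma Q.

(** The sets [BC.1] and [BC.2] are guesses for the states at the boundaries between regions. Clock
    values above [max_const] share one region, represented by [c.+1] in the last formula. *)
Fixpoint later_regions (n c : nat) A : formula Sigma Q :=
  if n is n'.+1 then
    ors (enum {: {set Q} * {set Q}}) (fun BC =>
      FAnd (rati f (open_itv c) (edge (c%:R + 2^-1)) A BC.1)
        (FAnd (rati f (point_itv c.+1) (edge c.+1%:R) BC.1 BC.2)
           (later_regions n' c.+1 BC.2)))
  else rati f (above_itv c) (edge c.+1%:R) A (ata_final M).

Definition general_formula (q : Q) : formula Sigma Q :=
  ors [seq AB : {set Q} * {set Q} <- enum {: {set Q} * {set Q}} | q \in AB.1]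
      (fun AB => FAnd (walk_through f (point_itv 0) (edge 0) AB.1 AB.2)
                    (later_regions max_const 0 AB.2)).

Lemma well_formed_general_formula S q :
  (forall p, well_formed false S (f p)) ->
  well_formed false S (general_formula q).
Proof.
move=> wf_f; apply: well_formed_ors => AB; apply: well_formed_and.
  exact: well_formed_walk_through.
elim: max_const 0%N AB.2 => [|n IH] c A /=; first exact: well_formed_rati.
apply: well_formed_ors => BC.
apply: well_formed_and; first exact: well_formed_rati.
by apply: well_formed_and; [apply: well_formed_rati | apply: IH].
Qed.

(** Every Rat_I used here has an interval without 0; distance 0 is left to [walk_through], which
    only uses FRat. *)
Lemma var_guarded_general_formula z q : var_guarded z (general_formula q).
Proof.
apply: var_guarded_ors => AB; split.
  exact: var_guarded_walk_through.
elim: max_const 0%N AB.2 => [|n IH] c A /=.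
  by left; rewrite in_above_itv -leNgt ler0n.
apply: var_guarded_ors => BC; split; last split=> //.
  by left; rewrite in_open_itv ltNge ler0n.
by left; rewrite in_point_itv eq_sym pnatr_eq0.
Qed.

Section Sat.
Variables (rho : timed_word R (letter Sigma)) (V : labelling Q rho).
Implicit Types (j k : tw_pos rho).
Local Notation T := (label f V).

(** Within one region the clock value can be frozen at a representative, which leaves an untimed
    finite automaton. *)
Lemma foldr_step_same_region m v j B (P : pred (tw_pos rho)) :
  (max_const <= m)%N ->
  (forall k, P k -> same_region m (tw_time k - tw_time j) v) ->
  foldr (fun k => step (tw_time k - tw_time j) (tw_sym k, T k)) B (positions P)
  = foldr (step v) B [seq letter_at f V k | k <- positions P].
Proof.
move=> cm eqv; have : all P (positions P).
  by apply/allP => k; rewrite mem_positions.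
elim: (positions P) => //= k s IH /andP[Pk /IH->].
exact: step_same_region cm (eqv k Pk).
Qed.

Lemma sat_later_regions n c A j : (max_const <= c + n)%N ->
  sat (later_regions n c A) V j <->
  A = backward T j (positions (fun k => c%:R < tw_time k - tw_time j)).
Proof.
elim: n c A => [|n IH] c A; rewrite ?addn0 => cm.
  rewrite [later_regions _ _ _]/=.
  rewrite sat_rati walk_edge.
  rewrite (eq_positions (P2 := fun k => c%:R < tw_time k - tw_time j));
    last first.
    by move=> k; rewrite in_above_itv.
  rewrite /backward (@foldr_step_same_region max_const c.+1%:R) => [|//|k].
    by split=> /eqP.
  exact: same_region_above.
(* Time is monotone, so the regions (c,c+1), [c+1,c+1] and beyond occupy consecutive blocks of
   positions. *)
have -> : positions (fun k => c%:R < tw_time k - tw_time j) =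
  positions (fun k => tw_time k - tw_time j \in itv_of R (open_itv c)) ++
  positions (fun k => tw_time k - tw_time j \in itv_of R (point_itv c.+1)) ++
  positions (fun k => c.+1%:R < tw_time k - tw_time j).
  rewrite -(@positions_cat _ _ _ (fun k => c.+1%:R <= tw_time k - tw_time j)).
  - apply: positions_cat => [k|k l].
      rewrite in_open_itv; have [h|h] := leP c.+1%:R (tw_time k - tw_time j).
        by rewrite andbF /= (lt_le_trans _ h) // ltr_nat.
      by rewrite andbT orbF.
    rewrite in_open_itv => /andP[_ h1] h2; apply: tw_time_lt.
    by rewrite -(ltrD2r (- tw_time j)) (lt_le_trans h1).
  - by move=> k; rewrite in_point_itv le_eqVlt eq_sym.
  - move=> k l; rewrite in_point_itv => /eqP h1 h2; apply: tw_time_lt.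
    by rewrite -(ltrD2r (- tw_time j)) h1.
rewrite /backward !foldr_cat.
rewrite (@foldr_step_same_region max_const (c%:R + 2^-1)) => [|//|k];
  last first.
  by rewrite in_open_itv; apply: same_region_open.
rewrite (@foldr_step_same_region max_const c.+1%:R) => [|//|k]; last first.
  by rewrite in_point_itv => /eqP->.
rewrite sat_ors.
split=> [[[B C] _ /sat_and[/sat_rati AB /sat_and[/sat_rati BC]]]|->].
  rewrite IH ?addSnnS // => Cfin; move: AB BC; rewrite !walk_edge.
  by move=> /eqP-> /eqP /= ->; rewrite /= in Cfin; rewrite Cfin.
(* The boundary states are those computed by the backward evaluation itself. *)
set C := foldr _ (ata_final M) _; set B := foldr _ C _.
exists (B, C); rewrite ?mem_enum // !sat_and !sat_rati !walk_edge !eqxx.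
by rewrite IH ?addSnnS.
Qed.

Lemma point_itv0_add (x y : R) : 0 <= x -> 0 <= y ->
  (x + y \in itv_of R (point_itv 0)) =
  (x \in itv_of R (point_itv 0)) && (y \in itv_of R (point_itv 0)).
Proof. by move=> x0 y0; rewrite !in_point_itv paddr_eq0. Qed.

Lemma sat_general_formula q j :
  sat (general_formula q) V j <-> q \in reset_value T j.
Proof.
rewrite /reset_value (@positions_cat _ _ _ _
  (fun k => (j < k)%N && (tw_time k - tw_time j \in itv_of R (point_itv 0)))
  (fun k => 0%:R < tw_time k - tw_time j)); first last.
- move=> k l /andP[_]; rewrite in_point_itv => /eqP h1 h2; apply: tw_time_lt.
  by rewrite -(ltrD2r (- tw_time j)) h1.
- move=> k; rewrite in_point_itv; case: ltnP => [jk|kj] /=.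
    by rewrite eq_sym -le_eqVlt subr_ge0 tw_time_le // ltnW.
  by rewrite ltNge subr_le0 tw_time_le.
rewrite /backward foldr_cat.
rewrite (@foldr_step_same_region max_const 0) => [|//|k]; last first.
  by case/andP=> _; rewrite in_point_itv => /eqP->.
rewrite sat_ors; split=> [[[A B]]|h].
  rewrite mem_filter => /andP[qA _] /sat_and[].
  rewrite (sat_walk_through _ _ point_itv0_add) walk_edge sat_later_regions //.
  by move=> /eqP eA eB; rewrite /= in eA eB qA; move: qA; rewrite eA eB.
move: h; set B := foldr _ (ata_final M) _; set A := foldr _ B _ => qA.
exists (A, B); first by rewrite mem_filter mem_enum qA.
apply/sat_and; rewrite (sat_walk_through _ _ point_itv0_add).
by rewrite walk_edge sat_later_regions.
Qed.

End Sat.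
End Formulas.

Lemma ata_to_sentence : exists psi : formula Sigma Q,
  well_formed false set0 psi /\
  forall rho, models rho psi <-> ata_accepts M rho.
Proof.
apply: (sentence_of_equations (phi := fun q f => general_formula f q)).
- by move=> q f S; apply: well_formed_general_formula.
- by move=> q f z; apply: var_guarded_general_formula.
- by move=> rho q f V j; apply: sat_general_formula.
Qed.

End GeneralCase.

(** * C+D automata *)

Lemma or_iff (P1 P2 P3 P4 : Prop) :
  (P1 <-> P3) -> (P2 <-> P4) -> (P1 \/ P2 <-> P3 \/ P4).
Proof. by move=> -> ->. Qed.

HB.instance Definition _ := gen_eqMixin nat_itv.

(** Complement within the nonnegative reals; the first interval may be empty, as [0,0) is. *)
Definition compl_itv (J : nat_itv) : seq nat_itv :=
  NatItv true 0 (Some (~~ itv_lo_closed J, itv_lo J)) ::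
  (if itv_hi J is Some (cl, h) then [:: NatItv (~~ cl) h None] else [::]).

Lemma in_compl_itv (R : realDomainType) (J : nat_itv) (v : R) : 0 <= v ->
  (v \notin itv_of R J) = has (fun J' => v \in itv_of R J') (compl_itv J).
Proof.
move=> v0; case: J => cl lo hi; rewrite /compl_itv /=.
have lowE : (v \in itv_of R (NatItv true 0 (Some (~~ cl, lo)))) =
            ~~ Order.lteif lo%:R v cl.
  by rewrite in_itv /= v0 /=; case: cl; rewrite /= ?leNgt ?ltNge ?negbK.
rewrite lowE in_itv /= negb_and; congr (_ || _).
case: hi => [[ch h]|] //=; rewrite orbF in_itv /= andbT.
by case: ch; rewrite /= ?leNgt ?ltNge ?negbK.
Qed.

Section CplusDCase.
Variables (R : realType) (Sigma : finType) (M : ata (letter Sigma)).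
Local Notation Q := (ata_loc M).
Local Notation alphabet := (letter Sigma * {set Q})%type.
Implicit Types (rho : timed_word R (letter Sigma)) (B X : {set Q}) (v : R).

(* The clause [(inl q, D)] stands for [q /\ b] and [(inr J, D)] for
   [x \in J /\ b], where [D] is the set of all sets of reset atoms making the
   reset formula [b] true. *)
Definition clause : Type := (Q + nat_itv) * {set {set Q}}.

Definition clause_sat v B X (c : clause) : bool :=
  (X \in c.2) &&
  match c.1 with inl q => q \in B | inr J => v \in itv_of R J end.

Definition clause_locs_in (Qs : {set Q}) (cl : seq clause) : bool :=
  all (fun c : clause => if c.1 is inl q then q \in Qs else true) cl.

Definition atoms_of B X : {set Q + Q} :=
  [set x | match x with inl p => p \in B | inr p => p \in X end].

(** The clock value 0 and the location set [set0] are dummies: a reset formula mentions neither. *)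
Definition reset_sets (b : tcond Q) : {set {set Q}} :=
  [set X | tcond_sat (0 : R) (atoms_of set0 X) b].

Lemma reset_comb_sat v B X b : reset_comb b ->
  tcond_sat v (atoms_of B X) b = (X \in reset_sets b).
Proof.
move=> rb; rewrite inE; elim: rb => //= [q|b1 b2 _ -> _ ->|b1 b2 _ -> _ ->] //.
by rewrite !inE.
Qed.

Lemma disj_form_clauses Qor phi : disj_form Qor phi ->
  exists2 cl, clause_locs_in Qor cl & forall v B X, 0 <= v ->
    tcond_sat v (atoms_of B X) phi = has (clause_sat v B X) cl.
Proof.
elim=> [q b qQ rb|J b rb|b rb|c1 c2 _ [cl1 in1 IH1] _ [cl2 in2 IH2]].
- exists [:: (inl q, reset_sets b)] => [|v B X _] /=; first by rewrite qQ.
  by rewrite /clause_sat (reset_comb_sat _ _ _ rb) inE orbF andbC.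
- exists [:: (inr J, reset_sets b)] => // v B X _ /=.
  by rewrite /clause_sat (reset_comb_sat _ _ _ rb) orbF andbC.
(* A bare reset formula receives a clock test that always succeeds. *)
- exists [:: (inr full_itv, reset_sets b)] => // v B X v0.
  rewrite (reset_comb_sat _ _ _ rb) /= /clause_sat /=.
  by rewrite in_full_itv v0 orbF andbT.
- exists (cl1 ++ cl2) => [|v B X v0].
    by rewrite /clause_locs_in all_cat; apply/andP.
  by rewrite has_cat /= IH1 // IH2.
Qed.

(** De Morgan: a negated location is a positive test in [~: B], a negated clock test splits over
    [compl_itv], and a negated reset formula has the complementary family of sets. *)
Lemma conj_form_clauses Qand phi : conj_form Qand phi ->
  exists2 cl, clause_locs_in Qand cl & forall v B X, 0 <= v ->
    ~~ tcond_sat v (atoms_of B X) phi = has (clause_sat v (~: B) X) cl.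
Proof.
elim=> [q b qQ rb|J b rb|b rb|c1 c2 _ [cl1 in1 IH1] _ [cl2 in2 IH2]].
- exists [:: (inl q, ~: reset_sets b)] => [|v B X _] /=; first by rewrite qQ.
  rewrite /clause_sat /= !in_setC -(reset_comb_sat v B _ rb).
  by rewrite inE orbF negb_or andbC.
- exists [seq (inr J', ~: reset_sets b) | J' <- compl_itv J] => [|v B X v0].
    by apply/allP => _ /mapP[J' _ ->].
  rewrite [tcond_sat _ _ _]/= negb_or (reset_comb_sat _ _ _ rb) in_compl_itv //.
  rewrite has_map /clause_sat; elim: (compl_itv J) => //= J' s <-.
  by rewrite in_setC andb_orl andbC.
- exists [:: (inr full_itv, ~: reset_sets b)] => // v B X v0.
  rewrite (reset_comb_sat _ _ _ rb) /= /clause_sat /= in_full_itv v0 orbF andbT.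
  by rewrite in_setC.
- exists (cl1 ++ cl2) => [|v B X v0].
    by rewrite /clause_locs_in all_cat; apply/andP.
  by rewrite has_cat /= negb_and IH1 // IH2.
Qed.

Variable Qand : {set Q}.

(* Complementing the conjunctive locations makes all transitions disjunctive. *)
Definition dualize B : {set Q} := [set q | (q \in B) (+) (q \in Qand)].

Lemma CplusD_clauses :
  (forall (q : Q) a, if q \in Qand then conj_form Qand (ata_trans q a)
                     else disj_form (~: Qand) (ata_trans q a)) ->
  exists cl : Q * letter Sigma -> seq clause, forall qa X B v,
    0 <= v -> (qa.1 \in dualize (step v (qa.2, X) B)) =
              has (clause_sat v (dualize B) X) (cl qa).
Proof.
move=> CD; pose P (qa : Q * letter Sigma) (cl : seq clause) :=
  forall X B v, 0 <= v -> (qa.1 \in dualize (step v (qa.2, X) B)) =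
                          has (clause_sat v (dualize B) X) cl.
suff /choice[cl clP] : forall qa, exists cl, P qa cl by exists cl.
case=> q a; rewrite /P /=.
(* Clauses of [q] name only locations of its own kind, where [dualize B] is [~: B] (conjunctive) or
   [B] (disjunctive). *)
have sameE (Qs : {set Q}) B B' cl v X : clause_locs_in Qs cl ->
    {in Qs, forall p, (p \in B) = (p \in B')} ->
    has (clause_sat v B X) cl = has (clause_sat v B' X) cl.
  move=> /allP clQ eqB; apply: eq_in_has => -[[p|J] D] /clQ //= pQ.
  by rewrite /clause_sat /= eqB.
have := CD q a; case: ifPn => qQ.
  case/conj_form_clauses=> cl clQ clE; exists cl => X B v v0.
  rewrite (sameE _ _ (~: B) _ _ _ clQ) => [|p pQ]; last first.
    by rewrite !inE pQ addbT.
  by rewrite -clE // !inE qQ addbT.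
case/disj_form_clauses=> cl clQ clE; exists cl => X B v v0.
rewrite (sameE _ _ B _ _ _ clQ) => [|p]; last first.
  by rewrite !inE => /negbTE->; rewrite addbF.
by rewrite -clE // !inE (negbTE qQ) addbF.
Qed.

Variable cl : Q * letter Sigma -> seq clause.
Hypothesis clP : forall qa X B v, 0 <= v ->
  (qa.1 \in dualize (step v (qa.2, X) B)) =
  has (clause_sat v (dualize B) X) (cl qa).

(** A clause holds either a location or a clock test, so moving on never depends on the clock; only
    stopping does. *)
Definition dual_edge (q : Q) (l : alphabet) (p : Q) : bool :=
  has (fun c : clause => (l.2 \in c.2) && (c.1 == inl p)) (cl (q, l.1)).

Definition stop_itvs (q : Q) (l : alphabet) : seq nat_itv :=
  pmap (fun c : clause => if c.1 is inr J then
    if l.2 \in c.2 then Some J else None else None) (cl (q, l.1)).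

Definition stops (q : Q) (l : alphabet) v : bool :=
  has (fun J => v \in itv_of R J) (stop_itvs q l).

Lemma dualize_step q l v B : 0 <= v ->
  (q \in dualize (step v l B)) =
  stops q l v || [exists p, dual_edge q l p && (p \in dualize B)].
Proof.
case: l => a X v0; rewrite (clP (q, a)) //.
rewrite /stops /stop_itvs /dual_edge; set D := dualize B.
elim: (cl _) => [|[[p|J] d] s IH] /=.
- by apply/esym/existsP => -[p].
- rewrite IH /clause_sat /= orbCA; congr (_ || _).
  apply/orP/existsP => [[/andP[ld pD]|/existsP[p' /andP[h p'D]]]|[p' /andP[]]].
  + by exists p; rewrite ld eqxx pD.
  + by exists p'; rewrite h orbT.
  case/orP=> [/andP[ld /eqP[->]] pD|h p'D]; first by left; rewrite ld.
  by right; apply/existsP; exists p'; rewrite h.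
- rewrite [clause_sat _ _ _ _]/= (_ : [exists p, _] =
    [exists p, has (fun c : clause => (X \in c.2) && (c.1 == inl p)) s
               && (p \in D)]); last first.
    by apply: eq_existsb => p; rewrite andbF.
  by rewrite IH /clause_sat /=; case: ifP => /= _; rewrite ?orbA.
Qed.

Section Formulas.
Variable f : Q -> formula Sigma Q.

(** The first disjunct covers paths that reach the end of the word, the second those stopped by a
    clock test. The stopping letter is the target of FRat, outside the walk. *)
Definition dual_formula (q : Q) : formula Sigma Q :=
  disj (ors (enum (dualize (ata_final M)))
          (fun p => walk_through f full_itv dual_edge q p))
       (ors (enum {: Q * alphabet}) (fun pl =>
          ors (stop_itvs pl.1 pl.2) (fun J =>
            frat f J dual_edge q pl.1 (is_letter f pl.2)))).

Definition CplusD_formula (q : Q) : formula Sigma Q :=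
  if q \in Qand then FNot (dual_formula q) else dual_formula q.

Lemma well_formed_CplusD_formula S q :
  (forall p, well_formed true S (f p)) ->
  well_formed true S (CplusD_formula q).
Proof.
move=> wf_f; suff h : well_formed true S (dual_formula q).
  by rewrite /CplusD_formula; case: ifP.
apply: well_formed_disj; apply: well_formed_ors => p.
  exact: well_formed_walk_through.
apply: well_formed_ors => J; apply: well_formed_frat => //.
exact: well_formed_is_letter.
Qed.

Lemma var_guarded_CplusD_formula z q : var_guarded z (CplusD_formula q).
Proof.
suff h : var_guarded z (dual_formula q) by rewrite /CplusD_formula; case: ifP.
split; apply: var_guarded_ors => p; first exact: var_guarded_walk_through.
exact: var_guarded_ors.
Qed.

Section Sat.
Variables (rho : timed_word R (letter Sigma)) (V : labelling Q rho).
Implicit Types (j k : tw_pos rho).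
Local Notation T := (label f V).
Local Notation ltr := (letter_at f V).

(** After dualization every step is an existential choice of one successor or of a stop, so the
    evaluation unfolds into a single path. *)
Lemma dualize_backward j (s : seq (tw_pos rho)) q :
  all (fun k => j <= k)%N s ->
  q \in dualize (backward T j s) <->
  (exists2 p, p \in dualize (ata_final M) & walk dual_edge q (map ltr s) p) \/
  (exists s1 k s2 p, [/\ s = s1 ++ k :: s2, walk dual_edge q (map ltr s1) p
                       & stops p (ltr k) (tw_time k - tw_time j)]).
Proof.
elim: s q => [|k s IH] q /=.
  move=> _; split=> [h|[[p h /eqP->] //|[[|? ?] [? [? [? []]]]] //]].
  by left; exists q.
case/andP=> jk js; rewrite dualize_step ?subr_ge0 ?tw_time_le //; split.
  case/orP=> [st|/existsP[p /andP[qp /IH[]]]] //.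
  - by right; exists [::], k, s, q; split=> //=.
  - move=> [r rF pr]; left; exists r => //; apply/existsP; exists p.
    by rewrite qp.
  - move=> [s1 [k' [s2 [r [-> pr st]]]]]; right; exists (k :: s1), k', s2, r.
    by split=> //=; apply/existsP; exists p; rewrite qp.
case=> [[r rF /existsP[p /andP[qp pr]]]|[[|k1 s1] [k' [s2 [r [[<- es]]]]]]].
- apply/orP; right; apply/existsP; exists p.
  by rewrite qp IH //; left; exists r.
- by move=> /eqP-> ->.
move=> /existsP[p /andP[qp pr]] st; apply/orP; right; apply/existsP; exists p.
by rewrite qp IH //; right; exists s1, k', s2, r.
Qed.

Lemma positions_split_unique j s1 k s2 :
  positions (fun l => j < l)%N = s1 ++ k :: s2 ->
  (j < k)%N /\ s1 = positions (fun l => j < l < k)%N.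
Proof.
move=> es; have jk : (j < k)%N.
  by rewrite -(mem_positions (fun l => j < l)%N) es mem_cat mem_head orbT.
have := pairwise_positions (fun l : tw_pos rho => j < l)%N.
rewrite es pairwise_cat allrel_consr /= => /and3P[/andP[/allP s1k _] ps1].
case/andP=> /allP ks2 _; split=> //; apply: positions_unique => // l.
rewrite [RHS]/in_mem /=; apply/idP/andP => [ls1|[jl lk]].
  split; last exact: s1k.
  by rewrite -(mem_positions (fun l => j < l)%N) es mem_cat ls1.
have : l \in s1 ++ k :: s2 by rewrite -es mem_positions.
rewrite mem_cat inE => /or3P[//|/eqP elk|/ks2]; first by rewrite elk ltnn in lk.
by rewrite ltnNge (ltnW lk).
Qed.

Lemma full_itv_add (x y : R) : 0 <= x -> 0 <= y ->
  (x + y \in itv_of R full_itv) =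
  (x \in itv_of R full_itv) && (y \in itv_of R full_itv).
Proof. by move=> x0 y0; rewrite !in_full_itv addr_ge0 // x0. Qed.

Lemma sat_dual_formula q j :
  sat (dual_formula q) V j <-> q \in dualize (reset_value T j).
Proof.
rewrite /reset_value dualize_backward; last first.
  by apply/allP => k; rewrite mem_positions => /ltnW.
have full_positions : positions (fun k =>
      (j < k)%N && (tw_time k - tw_time j \in itv_of R full_itv)) =
    positions (fun k => j < k)%N.
  apply: eq_positions => k /=; case: ltnP => //= jk.
  by rewrite in_full_itv subr_ge0 tw_time_le // ltnW.
rewrite sat_disj !sat_ors; apply: or_iff; split.
- case=> p pF /(sat_walk_through _ _ full_itv_add) h; exists p => //.
    by rewrite -mem_enum.
  by rewrite full_positions in h.
- case=> p pF h; exists p; first by rewrite mem_enum.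
  by apply/(sat_walk_through _ _ full_itv_add); rewrite full_positions.
- case=> -[p l] _ /sat_ors[J Jl /sat_frat[k [jk /sat_is_letter el kJ h]]].
  exists (positions (fun i => j < i < k)%N), k.
  exists (positions (fun i => k < i)%N), p.
  split=> //; first exact: positions_split.
  by rewrite -el; apply/hasP; exists J.
- case=> s1 [k [s2 [p [/positions_split_unique[jk ->] h /hasP[J Jl kJ]]]]].
  exists (p, ltr k); first by rewrite mem_enum.
  apply/sat_ors; exists J => //; apply/sat_frat; exists k; split=> //.
  exact/sat_is_letter.
Qed.

Lemma sat_CplusD_formula q j :
  sat (CplusD_formula q) V j <-> q \in reset_value T j.
Proof.
rewrite /CplusD_formula; case: ifPn => qQ.
  rewrite sat_not sat_dual_formula inE qQ addbT.
  by case: (q \in _); split=> // -[].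
by rewrite sat_dual_formula inE (negbTE qQ) addbF.
Qed.

End Sat.
End Formulas.

Lemma CplusD_clauses_to_sentence : exists psi : formula Sigma Q,
  well_formed true set0 psi /\
  forall rho, models rho psi <-> ata_accepts M rho.
Proof.
apply: (sentence_of_equations (phi := fun q f => CplusD_formula f q)).
- by move=> q f S; apply: well_formed_CplusD_formula.
- by move=> q f z; apply: var_guarded_CplusD_formula.
- by move=> rho q f V j; apply: sat_CplusD_formula.
Qed.

End CplusDCase.

Theorem theorem6 (R : realType) (Sigma : finType) :
  (forall A : ata (letter Sigma),
     exists (Z : finType) (psi : formula Sigma Z),
       [/\ is_sentence psi, guarded psi
         & forall rho : timed_word R (letter Sigma),
             models rho psi <-> ata_accepts A rho])
  /\
  (forall A : ata (letter Sigma), is_CplusD A ->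
     exists (Z : finType) (psi : formula Sigma Z),
       [/\ is_sentence psi, guarded psi, Rat_free psi
         & forall rho : timed_word R (letter Sigma),
             models rho psi <-> ata_accepts A rho]).
Proof.
split=> A.
  have [psi [[free_psi guarded_psi _] psiP]] := ata_to_sentence R A.
  by exists (ata_loc A), psi; split=> //; apply/eqP; rewrite -subset0.
case=> Qand /(CplusD_clauses R)[cl clP].
have [psi [[free_psi guarded_psi Rat_free_psi] psiP]] :=
  CplusD_clauses_to_sentence clP.
exists (ata_loc A), psi; split=> //; last exact: Rat_free_psi.
by apply/eqP; rewrite -subset0.
Qed.
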